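(* Let $\{X_\ell,f_\ell\}_{\ell=1}^{\infty}$ and $\{Y_\ell,g_\ell\}_{\ell=1}^{\infty}$ be inverse sequences of compact metric spaces and surjective continuous bonding functions. The following statements are equivalent. 1. There is a continuous surjection from $\varprojlim\{X_\ell,f_\ell\}_{\ell=1}^{\infty}$ to $\varprojlim\{Y_\ell,g_\ell\}_{\ell=1}^{\infty}$. 2. There is a sequence $(H_\ell)$ of upper semicontinuous functions $H_\ell:X_{\ell+1}\multimap Y_\ell$ such that (a) $g_k(H_{k+1}(x))\subseteq H_k(f_{k+1}(x))$ holds for each positive integer $k$ and for each $x\in X_{k+2}$, (b) for each positive integer $j\leq k$, $\lim_{k\to\infty}\operatorname{diam}(g_{j,k}(H_k(p_{k+1}(\mathbf x))))=0$ for any $\mathbf x\in\varprojlim\{X_\ell,f_\ell\}_{\ell=2}^{\infty}$.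
   Context: For compact metric spaces $X,Y$, a set-valued function $F:X\multimap Y$ is a function from $X$ to the set $2^Y$ of non-empty closed subsets of $Y$; it is upper semicontinuous if for each open $V\subseteq Y$ the set $\{x\in X\mid F(x)\subseteq V\}$ is open in $X$. For $A\subseteq X$, $F(A)=\bigcup_{x\in A}F(x)$. For continuous maps $f_\ell:X_{\ell+1}\to X_\ell$ between compact metric spaces, $\varprojlim\{X_\ell,f_\ell\}_{\ell=1}^\infty$ is the subspace of $\prod_{\ell=1}^\infty X_\ell$ of all $(x_1,x_2,\ldots)$ with $x_\ell=f_\ell(x_{\ell+1})$ for all $\ell$; $\varprojlim\{X_\ell,f_\ell\}_{\ell=2}^\infty$ is the analogous space of sequences $(x_2,x_3,\ldots)$, and $p_{k+1}$ sends such a sequence to its entry $x_{k+1}\in X_{k+1}$. Similarly for $\{Y_\ell,g_\ell\}$ with $g_\ell:Y_{\ell+1}\to Y_\ell$. For $j<k$, $g_{j,k}=g_j\circ\cdots\circ g_{k-1}:Y_k\to Y_j$, and $g_{k,k}$ is the identity on $Y_k$. In (b), $j$ is a fixed positive integer and the limit is over $k\geq j$.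
   Formalization: In statement 2 each upper semicontinuous function H_ℓ is additionally required to be surjective, H_ℓ(X_{ℓ+1}) = Y_ℓ; without this the equivalence fails (one-point X_ℓ, two-point Y_ℓ, identity bonding maps, constant H_ℓ). *)

(* Defs.v *)
From HB Require Import structures.
From mathcomp Require Import all_boot all_order all_algebra.
From mathcomp Require Import all_classical all_reals all_analysis.

Set Implicit Arguments.
Unset Strict Implicit.
Unset Printing Implicit Defensive.

Import Order.TTheory GRing.Theory Num.Theory.

Local Open Scope classical_set_scope.
Local Open Scope ring_scope.

(* Sequences are indexed from 0: X l, f l, Y l, g l, H l stand for the objects
   usually written with the index l + 1. *)

(* As a type, inv_lim f carries the subspace topology inherited from the
   product topology on prod_topology X = forall l, X l. *)
Definition inv_lim (X : nat -> topologicalType) (f : forall l, X l.+1 -> X l) :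
    set (prod_topology X) :=
  [set x | forall l, x l = f l (x l.+1)].

(* bond g j n is the composition g_{j,k} : Y_k -> Y_j with k = n + j. *)
Fixpoint bond (Y : nat -> Type) (g : forall l, Y l.+1 -> Y l) (j n : nat) :
    Y (n + j)%N -> Y j :=
  match n return Y (n + j)%N -> Y j with
  | 0 => fun y => y
  | n'.+1 => fun y => bond g (g (n' + j)%N y)
  end.

Definition set_valued (X : Type) (Y : topologicalType) (F : X -> set Y) : Prop :=
  forall x, F x !=set0 /\ closed (F x).

Definition upper_semicontinuous (X Y : topologicalType) (F : X -> set Y) : Prop :=
  forall V : set Y, open V -> open [set x | F x `<=` V].

Definition sv_image (X Y : Type) (F : X -> set Y) (A : set X) : set Y :=
  \bigcup_(x in A) F x.

Definition sv_surjective (X Y : Type) (F : X -> set Y) : Prop :=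
  sv_image F [set: X] = [set: Y].

Definition diam (R : realType) (T : metricType R) (A : set T) : \bar R :=
  ereal_sup [set (mdist p.1 p.2)%:E | p in A `*` A].

(* The functions H l are required to be surjective in the sense H l (X l.+1) =
   Y l.  Without this, constant single-valued functions H l = {y l}, for a
   fixed y in the inverse limit of Y, satisfy all the other conditions (take
   every X l to be a point), whether or not there is a surjection.
   In the last condition x ranges over the inverse limit of the sequence with
   its first term removed, so that the projection to X k.+1 is x k. *)
Definition usc_system (R : realType) (X Y : nat -> metricType R)
    (f : forall l, X l.+1 -> X l) (g : forall l, Y l.+1 -> Y l)
    (H : forall l, X l.+1 -> set (Y l)) : Prop :=
  [/\ forall l, [/\ set_valued (H l), upper_semicontinuous (H l)
                  & sv_surjective (H l)],
      forall k (x : X k.+2), g k @` H k.+1 x `<=` H k (f k.+1 x)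
    & forall (j : nat) (x : forall l, X l.+1),
        inv_lim (X := fun l => X l.+1) (fun l => f l.+1) x ->
        diam (bond g (j := j) (n := n) @` H (n + j)%N (x (n + j)%N))
          @[n --> \oo] --> 0%E].

(* Main.v *)
(* A surjection [h] between the limits gives [H l x], the set of [l]-th
   coordinates of [h z] over the threads [z] through [x].  Conversely, for a
   thread [x] the sets of threads [z] of [Y] with [z m] in [H m (x m.+1)] are
   compact and decrease with [m] by (a), so they have a common point, which (b)
   makes unique: it is [h x].  Working with whole threads of [Y] instead of
   their projections avoids all index arithmetic on [bond].  Upper
   semicontinuity of the single [H m] at which the diameter is small gives
   continuity of a coordinate of [h], and, for a thread [z] of [Y], a common
   point of the decreasing closed nonempty sets of threads [x] with [z m] in
   [H m (x m.+1)] is a preimage of [z]. *)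
Require Import Defs.
From mathcomp Require Import all_boot all_order all_algebra.
From mathcomp Require Import all_classical all_reals all_analysis.

Set Implicit Arguments.
Unset Strict Implicit.
Unset Printing Implicit Defensive.

Import Order.TTheory GRing.Theory Num.Theory.

Local Open Scope classical_set_scope.

(** * Decreasing sequences of sets in a compact space *)

Lemma nested_subset (T : Type) (C : nat -> set T) :
  (forall n, C n.+1 `<=` C n) -> forall m n, (m <= n)%N -> C n `<=` C m.
Proof.
move=> Cd m n /subnK; move: (n - m)%N => d; elim: d n => [_ <- //|d IH n <-].
by apply: subset_trans (Cd _) (IH _ _).
Qed.

Lemma nested_filter (T : Type) (C : nat -> set T) :
  (forall n, C n.+1 `<=` C n) -> Filter (filter_from [set: nat] C).
Proof.
move=> Cd; apply: filter_from_filter => [|m n _ _]; first by exists 0%N.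
exists (maxn m n) => // x Cx.
by split; apply: (nested_subset Cd _ Cx); [exact: leq_maxl|exact: leq_maxr].
Qed.

(** The sets [C n] generate a proper filter. A cluster point of it is in the closure of every [C n],
    hence in [C n]. *)
Lemma nested_compact (T : topologicalType) (C : nat -> set T) :
  compact [set: T] -> (forall n, closed (C n)) -> (forall n, C n !=set0) ->
  (forall n, C n.+1 `<=` C n) -> exists p, forall n, C n p.
Proof.
move=> cT cC C0 Cd.
have PF : ProperFilter (filter_from [set: nat] C).
  by apply: filter_from_proper => [|n _]; [exact: nested_filter|exact: C0].
have [p [_ clp]] := cT _ PF filterT.
exists p => n; apply: cC => B pB.
by apply: clp => //; exists n.
Qed.

(** * Inverse limits: topology, compactness and construction of threads *)

Section inverse_limit.
Variables (X : nat -> topologicalType) (f : forall l, X l.+1 -> X l).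

Definition lproj (l : nat) (x : inv_lim f) : X l := set_val x l.

Lemma lprojS l (x : inv_lim f) : lproj l x = f (lproj l.+1 x).
Proof. exact: (set_mem (valP x)). Qed.

Lemma lproj_eq_le l m (x y : inv_lim f) : (l <= m)%N ->
  lproj m x = lproj m y -> lproj l x = lproj l y.
Proof.
move=> /subnK <-; elim: (m - l)%N => // k IH xy.
by apply: IH; rewrite !(lprojS (k + l)) xy.
Qed.

Lemma lproj_inj (x y : inv_lim f) : (forall l, lproj l x = lproj l y) -> x = y.
Proof.
by move=> xy; apply: val_inj; apply: functional_extensionality_dep.
Qed.

Lemma thread_exists (x : forall l, X l) : (forall l, x l = f (x l.+1)) ->
  exists z : inv_lim f, forall l, lproj l z = x l.
Proof. by move=> xf; exists (@SigSub _ _ _ x (mem_set xf)). Qed.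

Lemma lproj_continuous l : continuous (lproj l).
Proof.
move=> x; apply: (@continuous_comp _ (prod_topology X) _ set_val (proj l)).
  exact: initial_continuous.
exact: proj_continuous.
Qed.

(** The topology of the limit is initial for [set_val], and that of the product is the supremum of
    the initial topologies of its coordinates; the proof unfolds these two layers in turn. *)
Lemma cvg_lproj (F : set_system (inv_lim f)) (x : inv_lim f) : Filter F ->
  (forall l, lproj l @ F --> lproj l x) -> F --> x.
Proof.
move=> FF Fx.
have Fx' : set_val @ F --> (set_val x : prod_topology X).
  apply/cvg_sup => l A [_ [[B oB <-] Bx] BA].
  have FB : F (lproj l @^-1` B) by apply: Fx; apply: open_nbhs_nbhs; split.
  by apply: (@filterS _ F _ _ _ _ FB) => z Bz; exact: BA.
move=> A [_ [[B oB <-] Bx] BA].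
have FB : F (set_val @^-1` B) by apply: Fx'; apply: open_nbhs_nbhs; split.
by apply: (@filterS _ F _ _ _ _ FB) => z Bz; exact: BA.
Qed.

Lemma continuous_lproj (T : topologicalType) (h : T -> inv_lim f) :
  (forall l, continuous (lproj l \o h)) -> continuous h.
Proof. by move=> hc x; apply: cvg_lproj => l; exact: hc. Qed.

Hypothesis hausX : forall l, hausdorff_space (X l).
Hypothesis contf : forall l, continuous (@f l).
Hypothesis cptX : forall l, compact [set: X l].

Lemma closed_inv_lim : closed (inv_lim f).
Proof.
have -> : inv_lim f =
    \bigcap_l [set x : prod_topology X | proj l x = f (proj l.+1 x)].
  by apply/seteqP; split=> x xf l => [_|]; exact: xf.
(* Two points of a Hausdorff space are equal once all their neighbourhoods [A] and [B] meet. A point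
   [y] close to [x] that satisfies the equation at [l] provides a common point. *)
apply: closed_bigI => l _ x clx /=; apply: hausX.
move=> A B nA nB.
have nA' : nbhs x (proj l @^-1` A) by exact: proj_continuous nA.
have nB' : nbhs x ((@f l \o proj l.+1) @^-1` B).
  by apply: (continuous_comp (g := @f l)) nB;
    [exact: proj_continuous|exact: contf].
have [y [/= yf [yA yB]]] := clx _ (filterI nA' nB').
by exists (proj l y); split => //; rewrite yf.
Qed.

(** Tychonoff gives compactness of the limit as a subset of the product. A filter on the subtype is
    pushed forward along [set_val], and the cluster point found there is read back as a thread. *)
Lemma compact_inv_lim : compact [set: inv_lim f].
Proof.
have cl : compact (inv_lim f : set (prod_topology X)).
  apply: (subclosed_compact closed_inv_lim (tychonoff cptX)) => x _ l //.
move=> F PF _.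
have [x [xf clx]] : inv_lim f `&` cluster (set_val @ F) !=set0.
  apply: cl; apply: (@filterS _ F _ _ _ _ filterT) => x _; exact: set_valP.
exists (@SigSub _ _ _ x (mem_set xf)).
split => // A B FA [_ [[C oC <-] Cx] CB].
have FA' : F (set_val @^-1` (set_val @` A)).
  by apply: (@filterS _ F _ _ _ _ FA) => w Aw; exists w.
have nC : nbhs (x : prod_topology X) C by apply: open_nbhs_nbhs; split.
have [_ [[w Aw <-] Cw]] := clx _ _ FA' nC.
by exists w; split => //; exact: CB.
Qed.

End inverse_limit.

(** Condition (b) speaks of threads without a first entry; this turns them into points of
    [inv_lim f]. *)
Lemma thread_prepend (X : nat -> topologicalType) (f : forall l, X l.+1 -> X l)
    (x : forall l, X l.+1) : (forall l, x l = f l.+1 (x l.+1)) ->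
  exists z : inv_lim f, forall l, lproj l.+1 z = x l.
Proof.
move=> xf.
pose y l : X l := if l is l'.+1 then x l' else f 0%N (x 0%N).
have [|z zy] := @thread_exists X f y; first by case.
by exists z => l; rewrite zy.
Qed.

(** At index 0, chosen right inverses of the bonding maps lift [y] step by step. At a successor, the
    induction hypothesis is applied to the sequence without its first space, which is why [X] and
    [f] are generalized, and the missing entry is then prepended. *)
Lemma lproj_surj (X : nat -> topologicalType) (f : forall l, X l.+1 -> X l) :
  (forall l, set_surj [set: X l.+1] [set: X l] (f l)) ->
  forall l (y : X l), exists z : inv_lim f, lproj l z = y.
Proof.
move=> + l; elim: l X f => [|l IH] X f fs y.
  have sP k : {s : X k -> X k.+1 & forall x, f k (s x) = x}.
    apply: (@choice _ _ (fun x y => f k y = x)) => x.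
    by have [z _ <-] := fs k x I; exists z.
  have [|z zy] := @thread_exists X f
      (fix u k := if k is k'.+1 then projT1 (sP k') (u k') else y).
    by move=> k /=; rewrite (projT2 (sP k)).
  by exists z; rewrite zy.
have [x xy] := IH (fun l => X l.+1) (fun l => f l.+1) (fun l => fs l.+1) y.
have [z zx] := @thread_prepend X f (fun l => lproj l x) (fun l => lprojS l x).
by exists z; rewrite zx.
Qed.

Lemma bond_lproj (Y : nat -> topologicalType) (g : forall l, Y l.+1 -> Y l)
    j n (z : inv_lim g) : bond g (lproj (n + j)%N z) = lproj j z.
Proof. by elim: n => //= n IH; rewrite -IH -lprojS. Qed.

Lemma bond_continuous (Y : nat -> topologicalType) (g : forall l, Y l.+1 -> Y l)
    j n : (forall l, continuous (g l)) -> continuous (@bond Y g j n).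
Proof.
move=> gc; elim: n => [|n IH] x /=; first exact: cvg_id.
by apply: (continuous_comp (f := g (n + j)%N) (g := @bond Y g j n));
  [exact: gc|exact: IH].
Qed.

(** * Closed sets obtained from semicontinuity and compactness *)

Lemma closed_usc_preimage (X Y : topologicalType) (H : X -> set Y) (y : Y) :
  closed [set y] -> upper_semicontinuous H -> closed [set x | H x y].
Proof.
move=> cy uH; rewrite -openC.
have -> : ~` [set x | H x y] = [set x | H x `<=` ~` [set y]].
  apply/seteqP; split => x /= Hx; last by move=> Hy; exact: (Hx y).
  by move=> z Hz /= zy; apply: Hx; rewrite -zy.
by apply: uH; rewrite openC.
Qed.

Lemma closed_image_compact (T U : topologicalType) (h : T -> U) (C : set T) :
  compact [set: T] -> hausdorff_space U -> continuous h -> closed C ->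
  closed (h @` C).
Proof.
move=> cT hU ch cC; apply: compact_closed => //.
apply: continuous_compact; first exact: continuous_subspaceT.
exact: subclosed_compact cC cT _.
Qed.

Lemma closed_preimage (T U : topologicalType) (h : T -> U) (C : set U) :
  continuous h -> closed C -> closed (h @^-1` C).
Proof. by move=> /continuous_closedP; exact. Qed.

(** * Diameters and their convergence to zero *)

Section diameter.
Variables (R : realType) (T : metricType R).
Implicit Types (A : set T) (x y : T).

Lemma closed_singleton x : closed [set x].
Proof.
exact/accessible_closed_set1/hausdorff_accessible/metric_hausdorff.
Qed.

Lemma mdist_le_diam A x y : A x -> A y -> ((mdist x y)%:E <= diam A)%E.
Proof. by move=> Ax Ay; apply: ereal_sup_ubound; exists (x, y). Qed.

Lemma diam_le A (e : R) :
  (forall x y, A x -> A y -> (mdist x y <= e)%R) -> (diam A <= e%:E)%E.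
Proof.
move=> Ae; apply: ge_ereal_sup => _ [[x y] [/= Ax Ay] <-].
by rewrite lee_fin; exact: Ae.
Qed.

Lemma diam_ge0 A : A !=set0 -> (0 <= diam A)%E.
Proof.
by move=> [x Ax]; apply: le_trans (mdist_le_diam Ax Ax); rewrite mdistxx.
Qed.

End diameter.

(** The bound for [e = 1] makes [u] eventually finite, so that convergence can be checked on real
    parts. *)
Lemma cvge0_nonneg (R : realType) (u : nat -> \bar R) :
  (forall n, (0 <= u n)%E) ->
  (forall e : R, (0 < e)%R -> \forall n \near \oo, (u n <= e%:E)%E) ->
  u n @[n --> \oo] --> 0%E.
Proof.
move=> u0 ue; apply/fine_cvgP; split.
  apply: filterS (ue 1%R ltr01) => n un.
  by rewrite ge0_fin_numE//; exact: le_lt_trans un (ltry _).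
apply/cvgrPdist_le => e e0.
apply: filterS (ue e e0) => n un /=.
rewrite sub0r normrN ger0_norm; last exact: fine_ge0.
rewrite -lee_fin fineK// ge0_fin_numE//; exact: le_lt_trans un (ltry _).
Qed.

(** * From a surjection of limits to set-valued functions *)

Section equivalence.
Variables (R : realType) (X Y : nat -> metricType R).
Variables (f : forall l, X l.+1 -> X l) (g : forall l, Y l.+1 -> Y l).
Hypothesis cptX : forall l, compact [set: X l].
Hypothesis cptY : forall l, compact [set: Y l].
Hypothesis contf : forall l, continuous (@f l).
Hypothesis contg : forall l, continuous (@g l).
Hypothesis surjf : forall l, set_surj [set: X l.+1] [set: X l] (@f l).
Hypothesis surjg : forall l, set_surj [set: Y l.+1] [set: Y l] (@g l).

Let cX : compact [set: inv_lim f].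
Proof.
by apply: compact_inv_lim => // l; exact: metric_hausdorff.
Qed.

Let cY : compact [set: inv_lim g].
Proof.
by apply: compact_inv_lim => // l; exact: metric_hausdorff.
Qed.

Lemma usc_system_of_surjection (h : inv_lim f -> inv_lim g) :
  continuous h -> set_surj [set: inv_lim f] [set: inv_lim g] h ->
  usc_system f g
    (fun l x => (lproj l \o h) @` (lproj l.+1 @^-1` [set x])).
Proof.
move=> ch sh.
have chl l : continuous (lproj l \o h).
  by move=> z; apply: continuous_comp; [exact: ch|exact: lproj_continuous].
split=> [l|k x _ [_ [z zx <-] <-]|j x xf].
- split=> [x|V oV|].
  + split.
      by have [z zx] := lproj_surj surjf x; exists (lproj l (h z)), z.
    apply: closed_image_compact => //; first exact: metric_hausdorff.
    apply: closed_preimage; first exact: lproj_continuous.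
    exact: closed_singleton.
  (* The points whose value is not inside [V] form the projection of the closed set of threads that
     [lproj l \o h] sends outside [V]; by compactness this projection is closed. *)
  + rewrite -[X in open X]setCK openC.
    have -> : ~` [set x | (lproj l \o h) @` (lproj l.+1 @^-1` [set x]) `<=` V] =
        lproj l.+1 @` ((lproj l \o h) @^-1` ~` V).
      apply/seteqP; split=> [x nH|_ [z nV <-] HV].
        apply: contrapT => nx; apply: nH => _ [z zx <-].
        by apply: contrapT => nV; apply: nx; exists z.
      by apply: nV; apply: HV; exists z.
    apply: closed_image_compact => //.
    * exact: metric_hausdorff.
    * exact: lproj_continuous.
    * by apply: closed_preimage => //; rewrite closedC.
  + apply/seteqP; split=> // y _.
    have [w wy] := lproj_surj surjg y.
    have [z _ zw] := sh w I.
    by exists (lproj l.+1 z) => //; exists z => //=; rewrite zw.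
- exists z; first by rewrite /= -zx -lprojS.
  by rewrite /= -lprojS.
- have [x' x'x] := thread_prepend xf.
  (* Agreement at one coordinate forces agreement at all earlier ones, so every neighbourhood of
     [x'] contains some [U n]. As [x (n + j)] is the entry of [x'] at [(n + j).+1], the value of the
     set-valued function there comes exactly from the threads in [U n]. *)
  pose U n : set (inv_lim f) :=
    [set z | lproj (n + j).+1 z = lproj (n + j).+1 x'].
  have Ud n : U n.+1 `<=` U n by move=> z; exact: lproj_eq_le.
  pose F := filter_from [set: nat] U.
  have FF : Filter F by exact: nested_filter.
  have Fx : F --> x'.
    apply: cvg_lproj => l A Al; exists l => // z Uz /=.
    suff -> : lproj l z = lproj l x' by exact: nbhs_singleton.
    by apply: lproj_eq_le Uz; rewrite -addnS leq_addr.
  apply: cvge0_nonneg => [n|e e0].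
    have [w wx] := lproj_surj surjf (x (n + j)%N).
    apply: diam_ge0; exists (bond g (lproj (n + j)%N (h w))).
    by exists (lproj (n + j)%N (h w)) => //; exists w.
  (* Radius [e / 2] around the centre [lproj j (h x')] keeps any two points of the image within
     [e]. *)
  have : nbhs x' ((lproj j \o h) @^-1` ball (lproj j (h x')) (e / 2)%R).
    by apply: chl; apply: nbhsx_ballx; exact: divr_gt0.
  move=> /Fx [n0 _ Un0].
  exists n0 => // n /= n0n.
  have hU z : lproj (n + j).+1 z = x (n + j)%N ->
      (mdist (lproj j (h x')) (lproj j (h z)) < e / 2)%R.
    move=> zx; have /Un0 : U n0 z.
      by apply: (nested_subset Ud n0n); rewrite /U /= x'x.
    by rewrite /= ballEmdist.
  apply: diam_le => _ _ [_ [z zx <-] <-] [_ [w wx <-] <-].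
  rewrite /= !bond_lproj ltW// [e in ltRHS]splitr.
  apply: le_lt_trans (metric_triangle _ (lproj j (h x')) _) _.
  by rewrite metric_sym ltrD// hU.
Qed.

(** * From set-valued functions back to a surjection *)

Section surjection_of_usc_system.
Variable H : forall l, X l.+1 -> set (Y l).
Hypothesis HH : usc_system f g H.

Let L (x : inv_lim f) m : set (inv_lim g) :=
  [set z | H (lproj m.+1 x) (lproj m z)].

Lemma usc_system_point (x : inv_lim f) :
  exists z : inv_lim g, forall m, H (lproj m.+1 x) (lproj m z).
Proof.
have [H1 H2 _] := HH.
apply: (nested_compact (C := L x)) => // m.
- apply: closed_preimage; first exact: lproj_continuous.
  by have [/(_ (lproj m.+1 x)) []] := H1 m.
- have [/(_ (lproj m.+1 x)) [[y Hy] _] _ _] := H1 m.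
  by have [z zy] := lproj_surj surjg y; exists z; rewrite /L /= zy.
(* With both coordinates written as images under the bonding maps, the inclusion is condition
   (a). *)
- move=> z Lz; rewrite /L /= (lprojS m z) (lprojS m.+1 x).
  by apply: H2; exists (lproj m.+1 z).
Qed.

(** A single index with small diameter is all that uniqueness and continuity take from (b).
    Convergence to 0 in the extended reals also yields the finiteness that makes [fine] faithful. *)
Lemma usc_system_diam (x : inv_lim f) j (e : R) : (0 < e)%R ->
  exists n,
    (diam (bond g (j := j) (n := n) @` H (lproj (n + j).+1 x)) < e%:E)%E.
Proof.
move=> e0; have [_ _ H3] := HH.
have := H3 j (fun l => lproj l.+1 x) (fun l => lprojS l.+1 x).
move=> /fine_cvgP [fin /cvgrPdist_lt /(_ e e0) lt].
have [n [nf nl]] := filter_ex (filterI fin lt).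
exists n; rewrite -(fineK nf) lte_fin.
by apply: le_lt_trans nl; rewrite /= sub0r normrN ler_norm.
Qed.

Lemma usc_system_mdist (x : inv_lim f) (z w : inv_lim g) j n :
  H (lproj (n + j).+1 x) (lproj (n + j) z) ->
  H (lproj (n + j).+1 x) (lproj (n + j) w) ->
  ((mdist (lproj j z) (lproj j w))%:E <=
   diam (bond g (j := j) (n := n) @` H (lproj (n + j).+1 x)))%E.
Proof.
move=> Hz Hw; rewrite -(bond_lproj j n z) -(bond_lproj j n w).
by apply: mdist_le_diam; [exists (lproj (n + j) z)|exists (lproj (n + j) w)].
Qed.

Lemma usc_system_unique (x : inv_lim f) (z w : inv_lim g) :
  (forall m, H (lproj m.+1 x) (lproj m z)) ->
  (forall m, H (lproj m.+1 x) (lproj m w)) -> z = w.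
Proof.
move=> Hz Hw; apply: lproj_inj => j.
apply: mdist_positivity; apply/eqP; rewrite eq_le mdist_ge0 andbT.
apply/ler_addgt0Pl => e e0; rewrite addr0.
have [n] := usc_system_diam x j e0; rewrite -lee_fin => /ltW.
exact: le_trans (usc_system_mdist (Hz _) (Hw _)).
Qed.

Lemma surjection_of_usc_system : exists h : inv_lim f -> inv_lim g,
  continuous h /\ set_surj [set: inv_lim f] [set: inv_lim g] h.
Proof.
have [h hP] := choice usc_system_point.
have [H1 H2 H3] := HH.
exists h; split.
  apply: continuous_lproj => j x A; rewrite -nbhs_ballE => -[e /= e0 eA].
  have [n dn] := usc_system_diam x j (divr_gt0 e0 (ltr0Sn R 1)).
  have [_ uH _] := H1 (n + j)%N.
  (* The image of [H (lproj (n + j).+1 x)] in [Y j] contains [lproj j (h x)] and has diameter below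
     [e / 2]. The remaining [e / 2] leaves a ball around each of its points, which puts the image in
     the interior of the ball of radius [e]. *)
  pose V := bond g (j := j) (n := n) @^-1` (ball (lproj j (h x)) e)^°.
  have oV : open V.
    move: (@bond_continuous _ g j n contg) => /continuousP; apply.
    exact: open_interior.
  have HV : H (lproj (n + j).+1 x) `<=` V.
    move=> y Hy; have nb : nbhs (bond g y) (ball (bond g y) (e / 2)%R).
      by apply: nbhsx_ballx; exact: divr_gt0.
    apply: filterS nb => u yu; rewrite [e]splitr; apply: ball_triangle yu.
    rewrite ballEmdist /= -lte_fin; apply: le_lt_trans dn.
    rewrite -(bond_lproj j n (h x)); apply: mdist_le_diam; last by exists y.
    by exists (lproj (n + j)%N (h x)) => //; exact: hP.
  have : nbhs x (lproj (n + j).+1 @^-1` [set a | H a `<=` V]).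
    by apply: lproj_continuous; apply: open_nbhs_nbhs; split => //; exact: uH.
  apply: filterS => u Hu; apply: eA.
  by have /interior_subset := Hu _ (hP u (n + j)%N); rewrite bond_lproj.
move=> z _.
(* Now [z] is fixed and the thread of [X] varies: upper semicontinuity makes [C m] closed,
   surjectivity of [H m] and of the projection makes it nonempty, and (a) makes the sequence
   decrease. *)
pose C m := [set x : inv_lim f | H (lproj m.+1 x) (lproj m z)].
have [|||x xz] := nested_compact (C := C) cX.
- move=> m; apply: (@closed_preimage _ _ (@lproj _ _ m.+1)
      [set x | H x (lproj m z)]); first exact: lproj_continuous.
  by apply: closed_usc_preimage; [exact: closed_singleton|have [] := H1 m].
- move=> m; have [_ _ sH] := H1 m.
  have [y _ Hy] : sv_image (@H m) setT (lproj m z) by rewrite sH.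
  by have [x xy] := lproj_surj surjf y; exists x; rewrite /C /= xy.
- move=> m x Hx; rewrite /C /= (lprojS m z) (lprojS m.+1 x).
  by apply: H2; exists (lproj m.+1 z).
by exists x => //; apply: usc_system_unique (hP x) xz.
Qed.

End surjection_of_usc_system.
End equivalence.

Theorem theorem4p7 (R : realType) (X Y : nat -> metricType R)
    (f : forall l : nat, X l.+1 -> X l) (g : forall l : nat, Y l.+1 -> Y l)
    (cptX : forall l : nat, compact [set: X l])
    (cptY : forall l : nat, compact [set: Y l])
    (contf : forall l : nat, continuous (f l))
    (contg : forall l : nat, continuous (g l))
    (surjf : forall l : nat, set_surj [set: X l.+1] [set: X l] (f l))
    (surjg : forall l : nat, set_surj [set: Y l.+1] [set: Y l] (g l)) :
  (exists h : inv_lim f -> inv_lim g,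
      continuous h /\ set_surj [set: inv_lim f] [set: inv_lim g] h)
  <->
  (exists H : forall l : nat, X l.+1 -> set (Y l), usc_system f g H).
Proof.
split=> [[h [ch sh]]|[H HH]].
  by eexists; exact: usc_system_of_surjection ch sh.
by apply: surjection_of_usc_system HH.
Qed.
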